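(* Let $d\ge 1$, let $\Omega=\operatorname{diag}(\omega_j)_{j=1}^d\in\mathbb{R}^{d\times d}$ with $\omega_j> 0$ for all $j$, let $\omega=\min_j\omega_j$, and let $A\in\mathbb{C}^{d\times d}$ be self-adjoint. Let $0<h\le 1$ and let $\psi_1,\phi\colon\mathbb{R}\to\mathbb{R}$ be even functions such that $\psi_1(\xi)=\operatorname{sinc}(\xi)\phi(\xi)$ for all $\xi\in\mathbb{R}$ and, for constants $c_0,c_1\ge 0$, \[ |\psi_1(\xi)|\le c_0,\qquad |\phi(\xi)|\le c_0,\qquad |\phi(\xi)-1|\le c_1|\xi|\qquad\text{for all }\xi\in\mathbb{R}. \] Assume $\omega\ge \tfrac12 c_0^2\|A\|+1$. Set $\Psi_1=\psi_1(h\Omega)$, $\Phi=\phi(h\Omega)$. For given $q_0,\dot q_0\in\mathbb{C}^d$, define $(q_n,\dot q_n)_{n\ge 0}$ recursively by \begin{align*} q_{n+1} &= \cos(h\Omega) q_n + h\operatorname{sinc}(h\Omega) \dot{q}_n - \tfrac12 h^2 \operatorname{sinc}(h\Omega) \Psi_1 A\Phi q_n,\\ \dot{q}_{n+1} &= -\Omega \sin(h\Omega) q_n + \cos(h\Omega) \dot{q}_n - \tfrac12 h \big( \cos(h\Omega) \Psi_1 A\Phi q_n + \Psi_1 A\Phi q_{n+1}\big), \end{align*} and let $H(q,\dot q)=\tfrac12 \|\Omega q\|^2 + \tfrac12 \|\dot{q}\|^2 + \tfrac12 q^*Aq$. Then \[ \big|H(q_n,\dot{q}_n) - H(q_0,\dot{q}_0)\big|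 \le C \min\big(h,\omega^{-1}\big) + C h^2 \qquad\text{for all } n\in\mathbb{N}, \] with a constant $C$ depending only on $c_0$, $c_1$, $\|A\|$, $\|\Omega q_0\|$ and $\|\dot{q}_0\|$.
   Context: $\|\cdot\|$ is the Euclidean norm on $\mathbb{C}^d$ and, for matrices, the induced operator norm; ${}^*$ denotes conjugate transpose. $\operatorname{sinc}(\xi)=\sin(\xi)/\xi$ for $\xi\ne0$ and $\operatorname{sinc}(0)=1$. For a function $f\colon\mathbb{R}\to\mathbb{R}$, $f(h\Omega)$ denotes the diagonal matrix $\operatorname{diag}(f(h\omega_j))_{j=1}^d$. *)

(* Defs.v *)
From mathcomp Require Import all_boot all_order all_algebra.
From mathcomp Require Import all_classical all_reals all_analysis.
From mathcomp Require Import complex.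
Set Implicit Arguments. Unset Strict Implicit. Unset Printing Implicit Defensive.
Import Order.TTheory GRing.Theory Num.Theory.
Local Open Scope ring_scope.
Local Open Scope complex_scope.

Section Defs.
Variable R : realType.
Local Notation C := R[i].

Definition sinc (x : R) : R := if x == 0 then 1 else sin x / x.

Definition cabs2 (z : C) : R := (complex.Re z) ^+ 2 + (complex.Im z) ^+ 2.
Definition vnorm d (v : 'cV[C]_d) : R := Num.sqrt (\sum_i cabs2 (v i 0)).

Definition opnorm d (A : 'M[C]_d) : R :=
  sup [set vnorm (A *m x) | x in [set x : 'cV[C]_d | vnorm x <= 1]].

Definition adjmx m n (M : 'M[C]_(m, n)) : 'M[C]_(n, m) := map_mx conjc M^T.
Definition selfadjoint d (A : 'M[C]_d) : Prop := adjmx A = A.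

Definition fdiag d (f : R -> R) (h : R) (w : 'I_d -> R) : 'M[C]_d :=
  diag_mx (\row_j (f (h * w j))%:C).
Definition Omega d (w : 'I_d -> R) : 'M[C]_d := diag_mx (\row_j (w j)%:C).

Definition even_fun (f : R -> R) : Prop := forall x, f (- x) = f x.

Definition step d (w : 'I_d -> R) (A : 'M[C]_d) (h : R) (psi1 phi : R -> R)
  (p : 'cV[C]_d * 'cV[C]_d) : 'cV[C]_d * 'cV[C]_d :=
  let: (q, qd) := p in
  let cosh := fdiag cos h w in
  let sinh := fdiag sin h w in
  let sinch := fdiag sinc h w in
  let Psi1 := fdiag psi1 h w in
  let Phi := fdiag phi h w in
  let hC := h%:C in
  let q1 := cosh *m q + hC *: (sinch *m qd)
            - (2^-1 * hC ^+ 2) *: (sinch *m Psi1 *m A *m Phi *m q) in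
  let qd1 := - (Omega w *m sinh *m q) + cosh *m qd
            - (2^-1 * hC) *: (cosh *m Psi1 *m A *m Phi *m q
                              + Psi1 *m A *m Phi *m q1) in
  (q1, qd1).

Definition traj d (w : 'I_d -> R) (A : 'M[C]_d) (h : R) (psi1 phi : R -> R)
  (q0 qd0 : 'cV[C]_d) (n : nat) : 'cV[C]_d * 'cV[C]_d :=
  iter n (step w A h psi1 phi) (q0, qd0).

(* energy; q^* A q is real for self-adjoint A, we take its real part *)
Definition energy d (w : 'I_d -> R) (A : 'M[C]_d) (q qd : 'cV[C]_d) : R :=
  2^-1 * vnorm (Omega w *m q) ^+ 2 + 2^-1 * vnorm qd ^+ 2
  + 2^-1 * complex.Re ((adjmx q *m A *m q) 0 0).

End Defs.

(* Main.v *)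
(* Put M = Phi A Phi and S = sinc(h Omega), so that Psi1 A Phi = S M and the
   method is a half kick [p = qd - h/2 S M q], an exact rotation, and another
   half kick.  The quadratic form
     E(q, qd) = |qd|^2/2 + |Omega q|^2/2 + Re <cos(h Omega) q, M q>/2
                - h^2 |S M q|^2/8
   is conserved exactly: in terms of the kicked velocity it equals
   (|p|^2 + |Omega q|^2)/2 + Re <q', M q>/2 with q' the next position, and this
   expression is symmetric under exchanging the two ends of the rotation.
   The lower bound on omega makes E coercive, which bounds |Omega q_n| for all n,
   and H - E is bounded in terms of |Omega q|^2: using |q| <= |Omega q|/omega
   gives the factor 1/omega, using |phi - 1| and |cos - 1| gives the factor h. *)

Require Import Defs.
From mathcomp Require Import all_boot all_order all_algebra.
From mathcomp Require Import all_classical all_reals all_analysis.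
From mathcomp Require Import complex ring lra.
Set Implicit Arguments. Unset Strict Implicit. Unset Printing Implicit Defensive.
Import Order.TTheory GRing.Theory Num.Theory.
Import numFieldNormedType.Exports.
Local Open Scope ring_scope.
Local Open Scope complex_scope.

(** * Real inner product on complex vectors, real diagonal matrices, operator norm *)

(** The real part makes the Hermitian product a symmetric real bilinear form, so all later estimates
    are real arithmetic. *)
Definition rdot (R : realType) (d : nat) (u v : 'cV[R[i]]_d) : R :=
  complex.Re ((adjmx u *m v) 0 0).

Definition rdiag (R : realType) (d : nat) (t : 'I_d -> R) : 'M[R[i]]_d :=
  diag_mx (\row_j (t j)%:C).

Lemma sqrp_le (R : realType) (x y : R) :
  0 <= y -> x ^+ 2 <= y ^+ 2 -> x <= y.
Proof.
move=> y0; apply: contraLR; rewrite -!ltNge => yx.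
by rewrite ltr_pXn2r ?nnegrE // (ltW (le_lt_trans y0 yx)).
Qed.

Section RealDot.
Variables (R : realType) (d : nat).
Implicit Types (u v x : 'cV[R[i]]_d) (A : 'M[R[i]]_d) (a : R) (t : 'I_d -> R).

Lemma ReD (x y : R[i]) : complex.Re (x + y) = complex.Re x + complex.Re y.
Proof. by case: x y => [a b] [c e]. Qed.

Lemma Re_sum (I : finType) (F : I -> R[i]) :
  complex.Re (\sum_i F i) = \sum_i complex.Re (F i).
Proof. exact: (big_morph (@complex.Re R) ReD erefl). Qed.

Lemma rdotE u v :
  rdot u v = \sum_i (complex.Re (u i 0) * complex.Re (v i 0)
                     + complex.Im (u i 0) * complex.Im (v i 0)).
Proof.
rewrite /rdot mxE Re_sum; apply: eq_bigr => i _; rewrite !mxE.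
by case: (u i 0) (v i 0) => [a b] [c e] /=; ring.
Qed.

Lemma rdotC u v : rdot u v = rdot v u.
Proof. by rewrite !rdotE; apply: eq_bigr => i _; ring. Qed.

Lemma rdotDr u v x : rdot x (u + v) = rdot x u + rdot x v.
Proof. by rewrite /rdot mulmxDr mxE ReD. Qed.

Lemma rdotDl u v x : rdot (u + v) x = rdot u x + rdot v x.
Proof. by rewrite rdotC rdotDr !(rdotC x). Qed.

Lemma rdotZr a u v : rdot u (a%:C *: v) = a * rdot u v.
Proof.
rewrite /rdot -scalemxAr mxE; case: ((adjmx u *m v) 0 0) => b c /=; ring.
Qed.

Lemma rdotZl a u v : rdot (a%:C *: u) v = a * rdot u v.
Proof. by rewrite rdotC rdotZr rdotC. Qed.

Lemma rdotNr u v : rdot u (- v) = - rdot u v.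
Proof. by rewrite -scaleN1r -[RHS]mulN1r -rdotZr rmorphN1. Qed.

Lemma rdotNl u v : rdot (- u) v = - rdot u v.
Proof. by rewrite rdotC rdotNr rdotC. Qed.

Lemma rdot_ge0 v : 0 <= rdot v v.
Proof.
by rewrite rdotE; apply: sumr_ge0 => i _; rewrite -!expr2 addr_ge0 ?sqr_ge0.
Qed.

Lemma vnorm_sqr v : vnorm v ^+ 2 = rdot v v.
Proof.
rewrite sqr_sqrtr; first by rewrite rdotE; apply: eq_bigr => i _; rewrite -!expr2.
by apply: sumr_ge0 => i _; rewrite addr_ge0 ?sqr_ge0.
Qed.

Lemma vnorm_ge0 v : 0 <= vnorm v.
Proof. exact: sqrtr_ge0. Qed.

Lemma rdotvv_eq0 u v : rdot v v = 0 -> rdot u v = 0.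
Proof.
rewrite !rdotE => /eqP.
rewrite psumr_eq0 => [|i _]; last by rewrite -!expr2 addr_ge0 ?sqr_ge0.
move=> /allP v0; apply: big1 => i _; have := v0 i (mem_index_enum i).
by rewrite /= -!expr2 paddr_eq0 ?sqr_ge0 // !sqrf_eq0 => /andP[/eqP -> /eqP ->];
  rewrite !mulr0 addr0.
Qed.

Lemma rdot_sqr_le u v : rdot u v ^+ 2 <= rdot u u * rdot v v.
Proof.
have [v0|vN0] := eqVneq (rdot v v) 0.
  by rewrite (rdotvv_eq0 _ v0) v0 expr0n mulr0.
have v_gt0 : 0 < rdot v v by rewrite lt_neqAle eq_sym vN0 rdot_ge0.
(* With z = <v,v> u - <u,v> v, one has |z|^2 = <v,v> (<u,u> <v,v> - <u,v>^2). *)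
have := rdot_ge0 ((rdot v v)%:C *: u + (- rdot u v)%:C *: v).
rewrite !(rdotDl, rdotDr, rdotZl, rdotZr) (rdotC v u) => ge0.
rewrite -subr_ge0 -(pmulr_rge0 _ v_gt0); move: ge0.
move: (rdot u u) (rdot u v) (rdot v v) => uu uv vv.
lra.
Qed.

Lemma rdot_le u v : `|rdot u v| <= vnorm u * vnorm v.
Proof.
apply: sqrp_le; first by rewrite mulr_ge0 ?vnorm_ge0.
by rewrite real_normK ?num_real // exprMn !vnorm_sqr rdot_sqr_le.
Qed.

Lemma vnormZ a v : vnorm (a%:C *: v) = `|a| * vnorm v.
Proof.
apply/eqP; rewrite -(eqrXn2 (n := 2)) ?mulr_ge0 ?vnorm_ge0 //.
by rewrite exprMn !vnorm_sqr rdotZl rdotZr real_normK ?num_real // mulrA expr2.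
Qed.

Lemma rdiagE t v i : (rdiag t *m v) i 0 = (t i)%:C * v i 0.
Proof. by rewrite /rdiag mul_diag_mx !mxE. Qed.

Lemma rdot_rdiag t u v : rdot (rdiag t *m u) v = rdot u (rdiag t *m v).
Proof.
rewrite !rdotE; apply: eq_bigr => i _; rewrite !rdiagE.
by case: (u i 0) (v i 0) => [a b] [c e] /=; ring.
Qed.

Lemma rdot_selfadjoint A u v :
  selfadjoint A -> rdot (A *m u) v = rdot u (A *m v).
Proof.
move=> sA; rewrite /rdot /adjmx trmx_mul map_mxM.
by move: sA; rewrite /selfadjoint /adjmx => ->; rewrite mulmxA.
Qed.

Lemma vnorm_rdiag_le t c v :
  (forall j, `|t j| <= c) -> vnorm (rdiag t *m v) <= c * vnorm v.
Proof.
(* The sign of [c] is read off from an entry of [t], so dimension 0, where all norms vanish, is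
   treated apart. *)
move=> tc; have [d0|] := posnP d.
  have n0 (x : 'cV[R[i]]_d) : vnorm x = 0.
    rewrite /vnorm big1 ?sqrtr0 // => i _.
    by case: (i) => m mlt; exfalso; move: mlt; rewrite d0.
  by rewrite !n0 mulr0.
move=> dgt0; have c0 : 0 <= c by apply: le_trans (tc (Ordinal dgt0)).
apply: sqrp_le; first by rewrite mulr_ge0 ?vnorm_ge0.
rewrite exprMn !vnorm_sqr !rdotE mulr_sumr; apply: ler_sum => i _.
rewrite rdiagE; case: (v i 0) => a b /=.
have tc2 : t i ^+ 2 <= c ^+ 2.
  by rewrite -[t i ^+ 2]real_normK ?num_real // ler_pXn2r ?nnegrE.
have := ler_wpM2r (addr_ge0 (sqr_ge0 a) (sqr_ge0 b)) tc2.
lra.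
Qed.

(** Guarantees that the supremum in [opnorm] is taken over a bounded set. Real and imaginary parts
    of each coordinate of A x are real inner products of x with [a i] and [b i], so Cauchy-Schwarz
    applies row by row. *)
Lemma mulmx_bounded A :
  exists2 K, 0 <= K & forall x, vnorm (A *m x) <= K * vnorm x.
Proof.
pose a i : 'cV[R[i]]_d := \col_j (A i j)^*%C.
pose b i : 'cV[R[i]]_d := \col_j (complex.Im (A i j) +i* complex.Re (A i j)).
pose K := \sum_i (rdot (a i) (a i) + rdot (b i) (b i)).
have K0 : 0 <= K by apply: sumr_ge0 => i _; rewrite addr_ge0 ?rdot_ge0.
exists (Num.sqrt K) => [|x]; first exact: sqrtr_ge0.
apply: sqrp_le; first by rewrite mulr_ge0 ?sqrtr_ge0 ?vnorm_ge0.
rewrite exprMn !vnorm_sqr sqr_sqrtr // mulr_suml rdotE.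
apply: ler_sum => i _; rewrite mulrDl -!expr2.
have -> : complex.Re ((A *m x) i 0) = rdot (a i) x.
  rewrite mxE Re_sum rdotE; apply: eq_bigr => j _; rewrite mxE.
  by case: (A i j) (x j 0) => [p q] [r s] /=; ring.
have -> : complex.Im ((A *m x) i 0) = rdot (b i) x.
  rewrite mxE rdotE.
  rewrite (big_morph (@complex.Im R) (id1 := 0) (op1 := +%R)) //;
    last by move=> [? ?] [? ?].
  apply: eq_bigr => j _; rewrite mxE.
  by case: (A i j) (x j 0) => [p q] [r s] /=; ring.
by apply: lerD; exact: rdot_sqr_le.
Qed.

Lemma has_ubound_opnorm A :
  has_ubound [set vnorm (A *m x) | x in [set x : 'cV[R[i]]_d | vnorm x <= 1]].
Proof.
have [K K0 AK] := mulmx_bounded A.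
exists K => _ [x /= x1 <-]; apply: le_trans (AK x) _.
by rewrite -[leRHS]mulr1 ler_wpM2l.
Qed.

Lemma opnorm_ge0 A : 0 <= opnorm A.
Proof.
apply: (ub_le_sup (has_ubound_opnorm A)); exists 0.
  by rewrite /= /vnorm big1 ?sqrtr0 // => i _; rewrite mxE /cabs2 /= expr0n addr0.
by rewrite mulmx0 /vnorm big1 ?sqrtr0 // => i _; rewrite mxE /cabs2 /= expr0n addr0.
Qed.

Lemma opnorm_le A x : vnorm (A *m x) <= opnorm A * vnorm x.
Proof.
have [x0|xN0] := eqVneq (vnorm x) 0.
  have [K K0 AK] := mulmx_bounded A.
  by apply: le_trans (AK x) _; rewrite x0 !mulr0.
have x_gt0 : 0 < vnorm x by rewrite lt_neqAle eq_sym xN0 vnorm_ge0.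
rewrite -ler_pdivrMr // mulrC -[_^-1]ger0_norm ?invr_ge0 ?vnorm_ge0 //.
rewrite -vnormZ scalemxAr; apply: (ub_le_sup (has_ubound_opnorm A)).
exists ((vnorm x)^-1%:C *: x) => //=.
by rewrite vnormZ ger0_norm ?invr_ge0 ?vnorm_ge0 // mulVf.
Qed.

End RealDot.

(** * Exact conservation of the modified energy *)

Section ModifiedEnergy.
Variables (R : realType) (d : nat) (w : 'I_d -> R) (A : 'M[R[i]]_d) (h : R).
Variables (psi1 phi : R -> R).
Implicit Types (q qd p : 'cV[R[i]]_d).

Local Notation Cos := (fdiag cos h w).
Local Notation Sin := (fdiag sin h w).
Local Notation Sinc := (fdiag (@sinc R) h w).
Local Notation Psi1 := (fdiag psi1 h w).
Local Notation Phi := (fdiag phi h w).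
Local Notation M := (Phi *m A *m Phi).

Lemma fdiagE (f : R -> R) q i : (fdiag f h w *m q) i 0 = (f (h * w i))%:C * q i 0.
Proof. exact: (rdiagE (fun j => f (h * w j))). Qed.

Lemma OmegaE q i : (Omega w *m q) i 0 = (w i)%:C * q i 0.
Proof. exact: rdiagE. Qed.

Lemma mul_sinc (x : R) : x * sinc x = sin x.
Proof.
rewrite /sinc; case: eqVneq => [->|x0]; first by rewrite mul0r sin0.
by rewrite mulrC divfK.
Qed.

(** The map is the exact flow over time h of uncoupled harmonic oscillators. In each coordinate
    cos^2 + (h w sinc)^2 = 1 factors out. *)
Lemma rotation_energy q p :
  vnorm (Omega w *m (Cos *m q + h%:C *: (Sinc *m p))) ^+ 2
    + vnorm (- (Omega w *m Sin *m q) + Cos *m p) ^+ 2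
  = vnorm (Omega w *m q) ^+ 2 + vnorm p ^+ 2.
Proof.
rewrite !vnorm_sqr !rdotE -!big_split; apply: eq_bigr => i _ /=.
rewrite -mulmxA !(OmegaE, fdiagE, mxE).
have s := mul_sinc (h * w i); have c := cos2Dsin2 (h * w i).
move: s c; move: (sinc _) (sin _) (cos _) => s t c <- ct.
case: (q i 0) (p i 0) => [a b] [e f] /=.
transitivity ((c ^+ 2 + (h * w i * s) ^+ 2)
  * (w i ^+ 2 * (a ^+ 2 + b ^+ 2) + (e ^+ 2 + f ^+ 2))); first by ring.
by rewrite ct; ring.
Qed.

(** Position part of the flow over time -h: cos and sinc are even, so only the factor h changes
    sign. *)
Lemma rotation_inverse q p :
  Cos *m (Cos *m q + h%:C *: (Sinc *m p))
    + (- h)%:C *: (Sinc *m (- (Omega w *m Sin *m q) + Cos *m p)) = q.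
Proof.
apply/matrixP => i j; rewrite ord1 -mulmxA !(OmegaE, fdiagE, mxE).
have s := mul_sinc (h * w i); have c := cos2Dsin2 (h * w i).
move: s c; move: (sinc _) (sin _) (cos _) => s t c <- ct.
have ctC : c%:C ^+ 2 + (h%:C * (w i)%:C * s%:C) ^+ 2 = 1 :> R[i].
  by rewrite -!(rmorphM, rmorphXn, rmorphD) ct rmorph1.
rewrite -[RHS]mul1r -ctC !rmorphM rmorphN; ring.
Qed.

(** The h^2 term of the position update is the first half kick carried along by the rotation. *)
Lemma stepE q qd
    (p : 'cV_d := qd - (h / 2)%:C *: (Psi1 *m A *m Phi *m q))
    (q1 : 'cV_d := Cos *m q + h%:C *: (Sinc *m p)) :
  step w A h psi1 phi (q, qd)
  = (q1, - (Omega w *m Sin *m q) + Cos *m p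
         - (h / 2)%:C *: (Psi1 *m A *m Phi *m q1)).
Proof.
have h2 : (h / 2)%:C = 2^-1 * h%:C :> R[i].
  by rewrite rmorphM fmorphV rmorph_nat mulrC.
have q1E : Cos *m q + h%:C *: (Sinc *m qd)
    - (2^-1 * h%:C ^+ 2) *: (Sinc *m Psi1 *m A *m Phi *m q) = q1.
  rewrite /q1 /p h2 mulmxBr scalerBr addrA -!scalemxAr scalerA !mulmxA.
  by congr (_ - _ *: _); ring.
rewrite /step q1E; clearbody q1.
by rewrite /p h2 mulmxBr scalerDr opprD !addrA -scalemxAr !mulmxA.
Qed.

(** The subtracted term is the kinetic energy of one half kick: 1/8 = 1/2 (1/2)^2. *)
Definition modified_energy q qd : R :=
  2^-1 * vnorm (Omega w *m q) ^+ 2 + 2^-1 * vnorm qd ^+ 2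
  + 2^-1 * rdot (Cos *m q) (M *m q)
  - 8^-1 * h ^+ 2 * vnorm (Psi1 *m A *m Phi *m q) ^+ 2.

Hypothesis sA : selfadjoint A.
Hypothesis psi1E : forall x, psi1 x = sinc x * phi x.

Lemma Psi1E q : Psi1 *m A *m Phi *m q = Sinc *m (M *m q).
Proof.
rewrite -!mulmxA; move: (A *m _) => v; apply/matrixP => i j.
by rewrite ord1 !fdiagE psi1E rmorphM mulrA.
Qed.

Lemma rdot_fdiag (f : R -> R) q p :
  rdot (fdiag f h w *m q) p = rdot q (fdiag f h w *m p).
Proof. exact: (rdot_rdiag (fun j => f (h * w j))). Qed.

(* Completing the square at the half-kicked velocity turns the modified energy
   into an expression in which [k = h] and [k = - h] are the positions reached
   by rotating forwards and backwards in time. *)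
Lemma modified_energy_kick (k : R) q p : k ^+ 2 = h ^+ 2 ->
  modified_energy q (p + (k / 2)%:C *: (Psi1 *m A *m Phi *m q))
  = 2^-1 * (vnorm (Omega w *m q) ^+ 2 + vnorm p ^+ 2)
    + 2^-1 * rdot (Cos *m q + k%:C *: (Sinc *m p)) (M *m q).
Proof.
move=> kh; rewrite /modified_energy -kh Psi1E !vnorm_sqr.
move: (Omega w *m q) (Cos *m q) (M *m q) => o c x.
have := rdot_fdiag (@sinc R) p x; move: (Sinc *m p) (Sinc *m x) => sp s.
rewrite !(rdotDl, rdotDr, rdotZl, rdotZr) (rdotC s p) => ->.
move: (rdot o o) (rdot p p) (rdot c x) (rdot p s) (rdot s s) => r1 r2 r3 r4 r5.
by field.
Qed.

Lemma modified_energy_step q qd :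
  modified_energy (step w A h psi1 phi (q, qd)).1 (step w A h psi1 phi (q, qd)).2
  = modified_energy q qd.
Proof.
rewrite stepE /=.
set p := qd - _; set q1 := _ + h%:C *: _; set r := _ + Cos *m p.
have -> : qd = p + (h / 2)%:C *: (Psi1 *m A *m Phi *m q) by rewrite subrK.
(* The kick formula is used with k = -h at the new position and k = h at the old one; the quadratic
   parts then agree by the rotation invariance. *)
rewrite -[- (_ *: _)]scaleNr -rmorphN -mulNr !modified_energy_kick ?sqrrN // rotation_energy.
rewrite -/q1 rotation_inverse; congr (_ + _ * _).
(* What remains is <q, M q1> = <q1, M q>, from the symmetry of A and of the real diagonal Phi. *)
rewrite -!mulmxA -rdot_fdiag -rdot_selfadjoint // rdotC.
by rewrite -rdot_fdiag.
Qed.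

Lemma modified_energy_traj q qd n :
  modified_energy (traj w A h psi1 phi q qd n).1 (traj w A h psi1 phi q qd n).2
  = modified_energy q qd.
Proof.
elim: n => //= n <-; rewrite /traj /=.
by case: (iter _ _ _) => q' qd'; rewrite modified_energy_step.
Qed.

End ModifiedEnergy.

(** * Scalar inequalities *)

Lemma ler_sqr_nneg (R : realType) (x y : R) : 0 <= x -> x <= y -> x ^+ 2 <= y ^+ 2.
Proof. by move=> x0 xy; rewrite lerXn2r ?nnegrE // (le_trans x0). Qed.

(** Mean value theorem on [0, x] with |sin| <= 1, after reduction to x >= 0 by evenness. *)
Lemma cos_sub1_le (R : realType) (x : R) : `|cos x - 1| <= `|x|.
Proof.
wlog x_ge0 : x / 0 <= x => [H|].
  by have [/H//|/ltW x_le0] := leP 0 x; rewrite -cosN -[`|x|]normrN H // oppr_ge0.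
have [->|x0] := eqVneq x 0; first by rewrite cos0 subrr normr0.
have x_gt0 : 0 < x by rewrite lt_neqAle eq_sym x0.
have [|c _] := @MVT R cos (fun y => - sin y) 0 x x_gt0
  (fun y _ => is_derive_cos y).
  by apply: continuous_subspaceT => y; exact: continuous_cos.
rewrite cos0 subr0 => ->; rewrite normrM normrN -[leRHS]mul1r.
by rewrite ler_wpM2r ?sin_max.
Qed.

(* [1 - (b + b^2 / 4) / (b / 2 + 1)^2 = (b / 2 + 1)^-2] is the fraction of
   [|Omega q|^2] that survives the negative terms of the modified energy. *)
Lemma coercivity_arith (R : realType) (b Q r W V k h : R) : 0 <= b -> 0 <= V ->
  - (b * Q ^+ 2) <= r -> h ^+ 2 * k <= (b * Q) ^+ 2 ->
  ((b / 2 + 1) * Q) ^+ 2 <= W ->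
  W <= (b / 2 + 1) ^+ 2
       * (2 * (2^-1 * W + 2^-1 * V + 2^-1 * r - 8^-1 * h ^+ 2 * k)).
Proof.
move=> b0 V0 rb kb bW.
(* The potential costs at most b Q^2, the kick term at most b^2 Q^2 / 4, and V is dropped. *)
have E2 : W - (b + b ^+ 2 / 4) * Q ^+ 2 <=
    2 * (2^-1 * W + 2^-1 * V + 2^-1 * r - 8^-1 * h ^+ 2 * k) by lra.
apply: le_trans (ler_wpM2l (sqr_ge0 _) E2).
have c : 0 <= b + b ^+ 2 / 4 by nra.
by have := ler_wpM2l c bW; lra.
Qed.

(** The shared terms W and V cancel. [D1] and [D2] stand for the two potential terms, [k] for the
    squared kick, [X] for a bound on |Omega q|^2 and [m] for min(h, 1/om). *)
Lemma perturbation_arith (R : realType) (W V D1 D2 k a B X m h : R) :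
  `|D1 - D2| <= B * X * m -> 0 <= k -> k <= a ^+ 2 * X ->
  `|2^-1 * W + 2^-1 * V + 2^-1 * D1
    - (2^-1 * W + 2^-1 * V + 2^-1 * D2 - 8^-1 * h ^+ 2 * k)|
  <= 2^-1 * B * X * m + 8^-1 * a ^+ 2 * X * h ^+ 2.
Proof.
rewrite ler_norml => /andP[D1l D1u] k0 kX.
have h1 := mulr_ge0 (sqr_ge0 h) k0; have h2 := ler_wpM2l (sqr_ge0 h) kX.
by rewrite ler_norml; apply/andP; split; lra.
Qed.

(** * Coercivity, and closeness of the energy to the modified energy *)

Section EnergyBounds.
Variables (R : realType) (d : nat) (w : 'I_d -> R) (om : R).
Variables (A : 'M[R[i]]_d) (h : R) (psi1 phi : R -> R) (c0 c1 : R).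
Implicit Types (q qd : 'cV[R[i]]_d).

Local Notation Cos := (fdiag cos h w).
Local Notation Psi1 := (fdiag psi1 h w).
Local Notation Phi := (fdiag phi h w).
Local Notation M := (Phi *m A *m Phi).
Local Notation a := (c0 ^+ 2 * opnorm A).
Local Notation E := (modified_energy w A h psi1 phi).

Hypotheses (om_le : forall j, om <= w j) (h_gt0 : 0 < h) (h_le1 : h <= 1).
Hypotheses (c0_ge0 : 0 <= c0) (c1_ge0 : 0 <= c1).
Hypotheses (psi1_le : forall x, `|psi1 x| <= c0) (phi_le : forall x, `|phi x| <= c0).
Hypothesis phi_sub1_le : forall x, `|phi x - 1| <= c1 * `|x|.
Hypothesis om_large : 2^-1 * c0 ^+ 2 * opnorm A + 1 <= om.

Lemma a_ge0 : 0 <= a.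
Proof. by rewrite mulr_ge0 ?sqr_ge0 ?opnorm_ge0. Qed.

Lemma om_ge1 : 1 <= om.
Proof. by have := a_ge0; have := om_large; lra. Qed.

Lemma w_gt0 j : 0 < w j.
Proof. by apply: lt_le_trans (om_le j); have := om_ge1; lra. Qed.

Lemma Omega_inv_mul (t : 'I_d -> R) q :
  rdiag t *m q = rdiag (fun j => t j / w j) *m (Omega w *m q).
Proof.
apply/matrixP => i j; rewrite ord1 !rdiagE mulrA -rmorphM.
by rewrite divfK // gt_eqF // w_gt0.
Qed.

Lemma mul_vnorm_le_Omega q : om * vnorm q <= vnorm (Omega w *m q).
Proof.
have om_gt0 : 0 < om by have := om_ge1; lra.
rewrite -ler_pdivlMl //.
have {1}-> : q = rdiag (fun j => (w j)^-1) *m (Omega w *m q).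
  apply/matrixP => i j; rewrite ord1 !rdiagE mulrA -rmorphM.
  by rewrite mulVf ?gt_eqF ?w_gt0 // rmorph1 mul1r.
apply: vnorm_rdiag_le => j; rewrite ger0_norm ?invr_ge0 ?(ltW (w_gt0 _)) //.
by rewrite lef_pV2 ?posrE ?w_gt0.
Qed.

Lemma vnorm_le_Omega q : vnorm q <= vnorm (Omega w *m q).
Proof.
apply: le_trans (mul_vnorm_le_Omega q).
by rewrite -[leLHS]mul1r ler_wpM2r ?vnorm_ge0 ?om_ge1.
Qed.

(** A filter error growing linearly in the frequency is absorbed by the factor Omega, uniformly in
    the size of the frequencies. *)
Lemma vnorm_sub_rdiag_le (t : 'I_d -> R) c q :
  (forall j, `|1 - t j| <= c * w j) ->
  vnorm (q - rdiag t *m q) <= c * vnorm (Omega w *m q).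
Proof.
move=> tc; have -> : q - rdiag t *m q = rdiag (fun j => 1 - t j) *m q.
  apply/matrixP => i j; rewrite ord1 [LHS]mxE [X in _ + X]mxE !rdiagE.
  by rewrite rmorphB rmorph1 mulrBl mul1r.
rewrite Omega_inv_mul; apply: vnorm_rdiag_le => j.
rewrite normrM normfV (gtr0_norm (w_gt0 j)).
by rewrite ler_pdivrMr ?w_gt0.
Qed.

Lemma vnorm_Phi_le q : vnorm (Phi *m q) <= c0 * vnorm q.
Proof. exact: vnorm_rdiag_le. Qed.

Lemma vnorm_Psi1_le q : vnorm (Psi1 *m q) <= c0 * vnorm q.
Proof. exact: vnorm_rdiag_le. Qed.

Lemma vnorm_Cos_le q : vnorm (Cos *m q) <= vnorm q.
Proof. by rewrite -[leRHS]mul1r; apply: vnorm_rdiag_le => j; exact: cos_max. Qed.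

Lemma vnorm_A_Phi_le q : vnorm (A *m Phi *m q) <= opnorm A * c0 * vnorm q.
Proof.
rewrite -mulmxA; apply: le_trans (opnorm_le _ _) _.
by rewrite -mulrA ler_wpM2l ?opnorm_ge0 ?vnorm_Phi_le.
Qed.

Lemma rdot_M_le q : `|rdot (Cos *m q) (M *m q)| <= a * vnorm q ^+ 2.
Proof.
rewrite -[M]mulmxA -mulmxA -rdot_fdiag; apply: le_trans (rdot_le _ _) _.
rewrite (_ : _ * _ ^+ 2 = (c0 * vnorm q) * (opnorm A * c0 * vnorm q)); last by ring.
apply: ler_pM; [exact: vnorm_ge0|exact: vnorm_ge0| |exact: vnorm_A_Phi_le].
by apply: le_trans (vnorm_Phi_le _) _; rewrite ler_wpM2l ?vnorm_Cos_le.
Qed.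

Lemma vnorm_Psi1_A_Phi_le q : vnorm (Psi1 *m A *m Phi *m q) <= a * vnorm q.
Proof.
rewrite -2!mulmxA; apply: le_trans (vnorm_Psi1_le _) _.
rewrite (_ : a * _ = c0 * (opnorm A * c0 * vnorm q)); last by ring.
by rewrite ler_wpM2l // mulmxA vnorm_A_Phi_le.
Qed.

Lemma Omega_le_modified_energy q qd :
  vnorm (Omega w *m q) ^+ 2 <= (a / 2 + 1) ^+ 2 * (2 * E q qd).
Proof.
have a0 := a_ge0; have := rdot_M_le q; rewrite ler_norml => /andP[rM _].
have kM : vnorm (Psi1 *m A *m Phi *m q) ^+ 2 <= (a * vnorm q) ^+ 2.
  exact: ler_sqr_nneg (vnorm_ge0 _) (vnorm_Psi1_A_Phi_le q).
(* The lower bound on [om] enters here: a/2 + 1 <= om and om |q| <= |Omega q|. *)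
have bQ : ((a / 2 + 1) * vnorm q) ^+ 2 <= vnorm (Omega w *m q) ^+ 2.
  apply: ler_sqr_nneg; first by rewrite mulr_ge0 ?vnorm_ge0 ?addr_ge0 ?divr_ge0.
  apply: le_trans (mul_vnorm_le_Omega q).
  by rewrite ler_wpM2r ?vnorm_ge0 //; have := om_large; lra.
have hk : h ^+ 2 * vnorm (Psi1 *m A *m Phi *m q) ^+ 2 <= (a * vnorm q) ^+ 2.
  apply: le_trans kM; rewrite -[leRHS]mul1r ler_wpM2r ?sqr_ge0 //.
  by rewrite expr_le1 // ltW.
exact: coercivity_arith a0 (sqr_ge0 _) rM hk bQ.
Qed.

(** Meant for the initial data, where it expresses the conserved value through |Omega q0| and
    |qd0|. *)
Lemma modified_energy_le q qd :
  2 * E q qd <= (1 + a) * vnorm (Omega w *m q) ^+ 2 + vnorm qd ^+ 2.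
Proof.
have a0 := a_ge0; have := rdot_M_le q; rewrite ler_norml => /andP[_ rM].
have QW : vnorm q ^+ 2 <= vnorm (Omega w *m q) ^+ 2.
  exact: ler_sqr_nneg (vnorm_ge0 _) (vnorm_le_Omega q).
have arith (b Q r W V k : R) : b * Q <= b * W -> 0 <= k -> r <= b * Q ->
    2 * (2^-1 * W + 2^-1 * V + 2^-1 * r - 8^-1 * h ^+ 2 * k) <= (1 + b) * W + V.
  by move=> bQ k0 rb; have := mulr_ge0 (sqr_ge0 h) k0; lra.
exact: arith (ler_wpM2l a0 QW) (sqr_ge0 _) rM.
Qed.

Lemma sub_Phi_Cos_le q :
  vnorm (q - Phi *m (Cos *m q)) <= (c0 + c1) * h * vnorm (Omega w *m q).
Proof.
have -> : Phi *m (Cos *m q) = rdiag (fun j => phi (h * w j) * cos (h * w j)) *m q.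
  by apply/matrixP => i j; rewrite ord1 !fdiagE rdiagE rmorphM mulrA.
apply: vnorm_sub_rdiag_le => j; have := cos_sub1_le (h * w j).
have := phi_sub1_le (h * w j); have := phi_le (h * w j).
have hw : 0 < h * w j by rewrite mulr_gt0 ?w_gt0.
rewrite (gtr0_norm hw); move: (phi _) (cos _) => f c f0 f1 c2.
(* The two pieces are bounded by c1 h w and c0 h w. *)
rewrite (_ : 1 - f * c = (1 - f) - f * (c - 1)); last by ring.
apply: le_trans (ler_normB _ _) _; rewrite normrM -[`|1 - f|]normrN opprB.
by have := ler_pM (normr_ge0 _) (normr_ge0 _) f0 c2; lra.
Qed.

Lemma sub_Phi_le q : vnorm (q - Phi *m q) <= c1 * h * vnorm (Omega w *m q).
Proof.
apply: (vnorm_sub_rdiag_le (t := fun j => phi (h * w j))) => j.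
have := phi_sub1_le (h * w j).
by rewrite -normrN opprB -mulrA (gtr0_norm (mulr_gt0 h_gt0 (w_gt0 j))).
Qed.

Lemma potential_diff_le_h q :
  `|rdot q (A *m q) - rdot (Cos *m q) (M *m q)|
  <= (c0 + c1 + c0 * c1) * opnorm A * vnorm (Omega w *m q) ^+ 2 * h.
Proof.
have n0 := opnorm_ge0 A; have QW := vnorm_le_Omega q.
(* With one Phi moved to the left argument, the difference telescopes: each summand contains one
   filter error of order h. *)
have -> : rdot q (A *m q) - rdot (Cos *m q) (M *m q)
  = rdot (q - Phi *m (Cos *m q)) (A *m q)
    + rdot (Phi *m (Cos *m q)) (A *m (q - Phi *m q)).
  rewrite mulmxBr rdotDr rdotNr rdotDl rdotNl -!mulmxA -!rdot_fdiag; ring.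
apply: le_trans (ler_normD _ _) _.
have t1 : `|rdot (q - Phi *m (Cos *m q)) (A *m q)|
    <= ((c0 + c1) * h * vnorm (Omega w *m q))
       * (opnorm A * vnorm (Omega w *m q)).
  apply: le_trans (rdot_le _ _) _; rewrite ler_pM ?vnorm_ge0 ?sub_Phi_Cos_le //.
  by apply: le_trans (opnorm_le _ _) _; rewrite ler_wpM2l.
have t2 : `|rdot (Phi *m (Cos *m q)) (A *m (q - Phi *m q))|
    <= (c0 * vnorm (Omega w *m q))
       * (opnorm A * (c1 * h * vnorm (Omega w *m q))).
  apply: le_trans (rdot_le _ _) _; rewrite ler_pM ?vnorm_ge0 //.
    apply: le_trans (vnorm_Phi_le _) _; rewrite ler_wpM2l //.
    exact: le_trans (vnorm_Cos_le _) _.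
  by apply: le_trans (opnorm_le _ _) _; rewrite ler_wpM2l ?sub_Phi_le.
by apply: le_trans (lerD t1 t2) _; lra.
Qed.

Lemma potential_diff_le_om q :
  `|rdot q (A *m q) - rdot (Cos *m q) (M *m q)|
  <= (opnorm A + a) * vnorm (Omega w *m q) ^+ 2 * om^-1.
Proof.
have om_gt0 : 0 < om by have := om_ge1; lra.
have n0 := opnorm_ge0 A.
apply: le_trans (ler_normB _ _) _.
have qA : `|rdot q (A *m q)| <= opnorm A * vnorm q ^+ 2.
  apply: le_trans (rdot_le _ _) _; rewrite mulrC expr2 mulrA.
  by rewrite ler_wpM2r ?vnorm_ge0 ?opnorm_le.
apply: le_trans (lerD qA (rdot_M_le q)) _.
rewrite -mulrDl -mulrA ler_wpM2l ?addr_ge0 ?a_ge0 // ler_pdivlMr //.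
(* No cancellation is used: of the two factors |q|, one is bounded by |Omega q| and the other by
   |Omega q| / om. *)
have := ler_pM (vnorm_ge0 _) (mulr_ge0 (ltW om_gt0) (vnorm_ge0 q))
  (vnorm_le_Omega q) (mul_vnorm_le_Omega q).
lra.
Qed.

Lemma energy_sub_modified_energy_le q qd X :
  vnorm (Omega w *m q) ^+ 2 <= X ->
  `|energy w A q qd - E q qd|
  <= 2^-1 * (opnorm A + a + (c0 + c1 + c0 * c1) * opnorm A) * X * Num.min h om^-1
     + 8^-1 * a ^+ 2 * X * h ^+ 2.
Proof.
move=> WX; have a0 := a_ge0; have n0 := opnorm_ge0 A.
have om_gt0 : 0 < om by have := om_ge1; lra.
have W0 := sqr_ge0 (vnorm (Omega w *m q)).
set K1 := opnorm A + a; set K2 := (c0 + c1 + c0 * c1) * opnorm A.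
have K1_ge0 : 0 <= K1 by rewrite addr_ge0.
have K2_ge0 : 0 <= K2 by rewrite mulr_ge0 // ?addr_ge0 ?mulr_ge0.
have m0 : 0 <= Num.min h om^-1 by rewrite le_min (ltW h_gt0) invr_ge0 (ltW om_gt0).
have D : `|rdot q (A *m q) - rdot (Cos *m q) (M *m q)|
    <= (K1 + K2) * X * Num.min h om^-1.
  apply: (@le_trans _ _ ((K1 + K2) * vnorm (Omega w *m q) ^+ 2 * Num.min h om^-1)).
    (* Each of the two bounds is weakened to the common constant [K1 + K2], so the smaller one can
       be chosen. *)
    rewrite minElt; case: ifP => _.
      apply: le_trans (potential_diff_le_h q) _.
      by rewrite ler_wpM2r ?(ltW h_gt0) // ler_wpM2r // lerDr.
    apply: le_trans (potential_diff_le_om q) _.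
    by rewrite ler_wpM2r ?invr_ge0 ?(ltW om_gt0) // ler_wpM2r // lerDl.
  by rewrite ler_wpM2r // ler_wpM2l ?addr_ge0.
have kX : vnorm (Psi1 *m A *m Phi *m q) ^+ 2 <= a ^+ 2 * X.
  apply: (@le_trans _ _ ((a * vnorm (Omega w *m q)) ^+ 2)).
    apply: ler_sqr_nneg; first exact: vnorm_ge0.
    apply: le_trans (vnorm_Psi1_A_Phi_le q) _.
    by rewrite ler_wpM2l ?vnorm_le_Omega.
  by rewrite exprMn ler_wpM2l ?sqr_ge0.
by rewrite /energy -mulmxA; exact: perturbation_arith D (sqr_ge0 _) kX.
Qed.

End EnergyBounds.

(** * Uniform bound along the trajectory and choice of the constant *)

Theorem theorem6 (R : realType) :
  exists Cst : R -> R -> R -> R -> R -> R,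
  forall (d : nat) (w : 'I_d -> R) (om : R) (A : 'M[R[i]]_d) (h : R)
         (psi1 phi : R -> R) (c0 c1 : R) (q0 qd0 : 'cV[R[i]]_d),
    (0 < d)%N ->
    (forall j, 0 < w j) ->
    (forall j, om <= w j) -> (exists j, w j = om) ->
    selfadjoint A ->
    0 < h -> h <= 1 ->
    even_fun psi1 -> even_fun phi ->
    (forall x, psi1 x = sinc x * phi x) ->
    0 <= c0 -> 0 <= c1 ->
    (forall x, `|psi1 x| <= c0) ->
    (forall x, `|phi x| <= c0) ->
    (forall x, `|phi x - 1| <= c1 * `|x|) ->
    2^-1 * c0 ^+ 2 * opnorm A + 1 <= om ->
    forall n : nat,
      `| energy w A (traj w A h psi1 phi q0 qd0 n).1
                     (traj w A h psi1 phi q0 qd0 n).2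
         - energy w A q0 qd0 |
      <= Cst c0 c1 (opnorm A) (vnorm (Omega w *m q0)) (vnorm qd0)
           * Num.min h om^-1
         + Cst c0 c1 (opnorm A) (vnorm (Omega w *m q0)) (vnorm qd0) * h ^+ 2.
Proof.
pose a (c0 n : R) := c0 ^+ 2 * n.
(* Bound on |Omega q_n|^2 for all n: the coercivity constant times the bound on twice the initial
   modified energy. *)
pose X c0 n W V := (a c0 n / 2 + 1) ^+ 2 * ((1 + a c0 n) * W ^+ 2 + V ^+ 2).
exists (fun c0 c1 n W V =>
  (n + a c0 n + (c0 + c1 + c0 * c1) * n + a c0 n ^+ 2) * X c0 n W V).
move=> d w om A h psi1 phi c0 c1 q0 qd0 _ _ om_le _ sA h_gt0 h_le1 _ _ psi1E
  c0_ge0 c1_ge0 psi1_le phi_le phi_sub1_le om_large n.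
set q := (traj _ _ _ _ _ _ _ _).1; set qd := (traj _ _ _ _ _ _ _ _).2.
have EnE0 : modified_energy w A h psi1 phi q qd = modified_energy w A h psi1 phi q0 qd0.
  exact: modified_energy_traj.
set Y := X c0 (opnorm A) _ _.
have E0_le := modified_energy_le h psi1 om_le c0_ge0 phi_le om_large q0 qd0.
have WY (p pd : 'cV[R[i]]_d) :
    modified_energy w A h psi1 phi p pd = modified_energy w A h psi1 phi q0 qd0 ->
    vnorm (Omega w *m p) ^+ 2 <= Y.
  move=> EE; apply: le_trans (Omega_le_modified_energy om_le h_gt0 h_le1 c0_ge0
    psi1_le phi_le om_large p pd) _.
  by rewrite EE ler_wpM2l ?sqr_ge0.
have B (p pd : 'cV[R[i]]_d) (EE : modified_energy w A h psi1 phi p pd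
    = modified_energy w A h psi1 phi q0 qd0) :=
  energy_sub_modified_energy_le om_le h_gt0 c0_ge0 c1_ge0 psi1_le phi_le
    phi_sub1_le om_large pd (WY p pd EE).
have Y0 : 0 <= Y by apply: le_trans (WY q qd EnE0); exact: sqr_ge0.
have := B q qd EnE0; have := B q0 qd0 erefl; rewrite EnE0 -/(a _ _).
have n0 := opnorm_ge0 A; have a0 : 0 <= a c0 (opnorm A) by rewrite mulr_ge0 ?sqr_ge0.
have om_gt0 : 0 < om by move: a0; rewrite /a; lra.
have m0 : 0 <= Num.min h om^-1 by rewrite le_min (ltW h_gt0) invr_ge0 (ltW om_gt0).
set K1 := _ + _ + _ * _; move=> B0 Bn.
have K1_ge0 : 0 <= K1 by rewrite !addr_ge0 // mulr_ge0 // !addr_ge0 // mulr_ge0.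
have s1 : 0 <= a c0 (opnorm A) ^+ 2 * Y * Num.min h om^-1.
  by rewrite mulr_ge0 ?sqr_ge0 // mulr_ge0 ?sqr_ge0.
have s2 : 0 <= K1 * Y * h ^+ 2 by rewrite mulr_ge0 ?sqr_ge0 // mulr_ge0 ?sqr_ge0.
have s3 : 0 <= a c0 (opnorm A) ^+ 2 * Y * h ^+ 2 by rewrite mulr_ge0 ?sqr_ge0 // mulr_ge0 ?sqr_ge0.
(* Two halves of [K1] and two eighths of a^2 are covered by one constant K1 + a^2; [s1], [s2], [s3]
   supply the slack. *)
have combine (x y : R) :
    x <= 2^-1 * K1 * Y * Num.min h om^-1 + 8^-1 * a c0 (opnorm A) ^+ 2 * Y * h ^+ 2 ->
    y <= 2^-1 * K1 * Y * Num.min h om^-1 + 8^-1 * a c0 (opnorm A) ^+ 2 * Y * h ^+ 2 ->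
    x + y <= (K1 + a c0 (opnorm A) ^+ 2) * Y * Num.min h om^-1
           + (K1 + a c0 (opnorm A) ^+ 2) * Y * h ^+ 2.
  move: s1 s2 s3; clear; move: (opnorm A) (Num.min _ _) => *; lra.
apply: le_trans (combine _ _ Bn B0).
(* Triangle inequality through the conserved modified energy, equal at times 0 and n. *)
rewrite [X in _ <= _ + X]distrC; exact: ler_distD.
Qed.
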